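(* Fix $0<\varepsilon\le 1$. For an odd prime $p$ and integer $\ell\ge1$ let $S_\ell(p)=\sum_{n\le\ell}\left(\frac{n}{p}\right)$ (Legendre symbol). For $x\ge 2$ let $\pi_{\mathrm{odd}}(x)$ be the number of odd primes $p\le x$, and for integers $\ell\ge1$ define $$P_\ell(x):=\frac{1}{\pi_{\mathrm{odd}}(x)}\#\{p\le x \text{ odd prime}:\ S_\ell(p)\ge \varepsilon\ell\}.$$ Fix $\kappa\in(0,1/6)$. Then for any real $\beta$ with $0<\beta<\frac13-2\kappa$, $$\sum_{\ell>x^{1/6-\kappa}}P_\ell(x)\ll_{\varepsilon,\kappa,\beta}x^{-\beta}.$$
   Context: $f\ll_{z_1,\dots,z_r} g$ means $|f|\le Cg$ with $C$ depending only on $z_1,\dots,z_r$, for all sufficiently large $x$. *)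

(* Defs.v *)
From Stdlib Require Import Reals ZArith.
From mathcomp Require Import ssreflect ssrfun ssrbool eqtype ssrnat seq div
  fintype prime.

Set Implicit Arguments.
Unset Strict Implicit.
Unset Printing Implicit Defensive.

Definition Rleb (a b : R) : bool := if Rle_dec a b then true else false.

Definition legendre (p n : nat) : Z :=
  if p %| n then 0%Z
  else if [exists y : 'I_p, (y * y) %% p == n %% p] then 1%Z else (-1)%Z.

Definition S_sum (l p : nat) : Z :=
  foldr Z.add 0%Z (map (legendre p) (iota 1 l)).

(* list of odd primes p <= x (every such p is < up x) *)
Definition odd_primes_upto (x : R) : seq nat :=
  [seq p <- iota 0 (Z.to_nat (up x)) | odd p && prime p && Rleb (INR p) x].

Definition pi_odd (x : R) : nat := size (odd_primes_upto x).

Definition P_l (eps : R) (l : nat) (x : R) : R :=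
  INR (count (fun p => Rleb (eps * INR l) (IZR (S_sum l p))) (odd_primes_upto x))
  / INR (pi_odd x).

Definition tail_partial_sum (eps : R) (y : R) (N : nat) (x : R) : R :=
  foldr Rplus 0%R
    (map (fun l => P_l eps l x) [seq l <- iota 1 N | ~~ Rleb (INR l) y]).

(* Main.v *)
Require Import Defs.
From Stdlib Require Import Reals ZArith.
From mathcomp Require Import ssreflect ssrfun ssrbool eqtype ssrnat seq div
  fintype prime.
From Stdlib Require Import Lra Lia.
From mathcomp Require Import choice finfun bigop finset binomial order ssralg ssrnum.
From mathcomp Require Import fingroup cyclic finalg zmodp.
From mathcomp Require Import zify ssrZ ring.

(** The proof replaces eps by 1/m and calls (p, l) biased when l <= m S_l(p).

    A biased pair has l^2 << p.  If S_l(p) >= l/m then all windows of length l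
    starting at s <= l/(4m) still have sum at least l/(2m), while the
    correlations of the Legendre symbol give a mean square of at most l for the
    window sums over all s mod p.

    For fixed l > x^(1/6-kappa) only x^o(1) primes p <= x are biased.  Choose k
    with l^k >= x^3 and sum S_l(p)^k = sum_t (t_1...t_k / p) over the set B of
    biased primes.  Cauchy-Schwarz and duality reduce this to the sums
    sum_{n <= l^k} (n/p)(n/q), which are at most pq <= x^2 for p <> q by
    periodicity; the multiplicity of n as a product t_1...t_k is handled by the
    divisor bound.

    Hence sum_l P_l(x) << x^(1/2) x^o(1) / pi(x), and a Chebyshev lower bound
    for pi(x) makes this O(x^(-1/3)).  The error exponents are fixed so that
    everything up to the last step is an inequality between 12th powers of
    natural numbers. *)

Set Implicit Arguments.
Unset Strict Implicit.
Unset Printing Implicit Defensive.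

Import Order.TTheory GRing.Theory Num.Theory.

Local Open Scope ring_scope.

(** * The quadratic character of a finite field *)

Definition qchar (F : finFieldType) (x : F) : Z :=
  if x == 0 then 0 else if [exists y : F, y ^+ 2 == x] then 1 else -1.

Section QuadraticCharacter.
Variable F : finFieldType.
Hypothesis two_neq0 : 2%:R != 0 :> F.
Implicit Types x y c d : F.

Lemma qchar0 : qchar (0 : F) = 0.
Proof. by rewrite /qchar eqxx. Qed.

Lemma qchar_sqr y : y != 0 -> qchar (y ^+ 2) = 1.
Proof.
move=> y0; rewrite /qchar expf_eq0 (negPf y0) /=.
by case: existsP => // -[]; exists y.
Qed.

Lemma qchar_bound x : -1 <= qchar x <= 1.
Proof. by rewrite /qchar; case: ifP => // _; case: ifP. Qed.

Lemma finField_generator :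
  exists g : F, g != 0 /\ forall x, x != 0 -> exists i, x = g ^+ i.
Proof.
have /cyclicP[g gE] := field_unit_group_cyclic [set: {unit F}]%G.
exists (FinRing.uval g); split=> [|x x0].
  by rewrite -unitfE; apply: (valP g).
have ux : x \is a GRing.unit by rewrite unitfE.
have : FinRing.unit F ux \in [set: {unit F}]%G by rewrite inE.
rewrite /= gE => /cycleP[i xE]; exists i.
by rewrite -FinRing.val_unitX -xE.
Qed.

Lemma qcharM x y : qchar (x * y) = qchar x * qchar y.
Proof.
have [->|x0] := eqVneq x 0; first by rewrite mul0r qchar0 mul0r.
have [->|y0] := eqVneq y 0; first by rewrite mulr0 qchar0 mulr0.
have sqM a b : a != 0 -> b != 0 -> qchar (a ^+ 2 * b) = qchar b.
  move=> a0 b0; rewrite /qchar mulf_eq0 expf_eq0 (negPf a0) (negPf b0) /=.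
  congr (if _ then _ else _).
  apply/existsP/existsP => -[z /eqP zE].
    by exists (z / a); rewrite expr_div_n zE mulrC mulKf ?expf_neq0.
  by exists (a * z); rewrite exprMn zE.
have [g [g0 gen]] := finField_generator.
have [i xE] := gen _ x0; have [j yE] := gen _ y0.
have gqchar n : qchar (g ^+ n) = qchar (g ^+ odd n).
  rewrite -{1}(odd_double_half n) addnC exprD -muln2 exprM sqM ?expf_neq0 //.
rewrite xE yE -exprD gqchar (gqchar i) (gqchar j) oddD.
have c1 : qchar (1 : F) = 1 by rewrite -(expr1n _ 2) qchar_sqr ?oner_eq0.
case: (odd i) (odd j) => [] [] /=; rewrite ?expr0 ?c1 ?mul1r ?mulr1 //.
by rewrite /qchar expf_eq0 /= (negPf g0); case: ifP.
Qed.

(** Otherwise squaring would be onto, hence injective by finiteness, although 1 and -1 are distinct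
    with equal squares. *)
Lemma nonsquare_exists : exists c, qchar c = -1.
Proof.
case: (pickP (fun c => qchar c == -1)) => [c /eqP|sq]; first by exists c.
have surj x : exists y, y ^+ 2 = x.
  have [->|x0] := eqVneq x 0; first by exists 0; rewrite expr0n.
  have := sq x; rewrite /qchar (negPf x0).
  by case: existsP => // -[y /eqP]; exists y.
pose r x := odflt 0 [pick y : F | y ^+ 2 == x].
have rK : cancel r (fun y => y ^+ 2).
  move=> x; rewrite /r; case: pickP => [y /eqP //|/= no].
  by have [y yE] := surj x; move: (no y); rewrite yE eqxx.
have /can_inj inj : cancel (fun y : F => y ^+ 2) r by apply: canF_sym.
have /eqP : (1 : F) = -1 by apply: inj; rewrite sqrrN.
by rewrite -subr_eq0 opprK -[1 + 1]/(2%:R) (negPf two_neq0).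
Qed.

(** Multiplication by a nonsquare permutes the field and flips every sign. *)
Lemma sum_qchar : \sum_(x : F) qchar x = 0.
Proof.
have [c cE] := nonsquare_exists.
have c0 : c != 0 by apply/eqP => c0; move: cE; rewrite c0 qchar0.
suff : \sum_(x : F) qchar x = - \sum_(x : F) qchar x by lia.
rewrite [LHS](reindex_inj (mulfI c0)) /= -sumrN.
by apply: eq_bigr => x _; rewrite qcharM cE mulN1r.
Qed.

(** For [x != 0], writing [x + d = x * (1 + d / x)] turns the summand into [qchar (1 + d / x)]: a
    complete character sum with one value missing. *)
Lemma qchar_correlation d :
  d != 0 -> \sum_(x : F) qchar x * qchar (x + d) = -1.
Proof.
move=> d0.
have inj : injective (fun x : F => 1 + d * x^-1).
  by move=> x y /addrI /(mulfI d0) /invr_inj.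
(* As [0^-1 = 0], the map permutes the whole field; it sends 0 to 1, so the term split off is
   [qchar 1 = 1]. *)
have := sum_qchar; rewrite (reindex_inj inj) /= (bigD1 0) //=.
rewrite [in X in _ -> X](bigD1 0) //=.
rewrite invr0 mulr0 addr0 qchar0 mul0r add0r.
rewrite -(expr1n _ 2) qchar_sqr ?oner_eq0 // expr1n => S0.
apply: (@addrI _ 1); rewrite -[RHS]S0; congr (_ + _).
apply: eq_bigr => x x0.
have -> : x + d = x * (1 + d * x^-1) by field.
by rewrite [in LHS]qcharM mulrA -qcharM -expr2 qchar_sqr // mul1r.
Qed.

(** Only an upper bound is wanted, so the off-diagonal value -1 is relaxed to 0. *)
Lemma qchar_autocorrelation c d :
  \sum_(x : F) qchar (x + c) * qchar (x + d) <= if c == d then #|F|%:R else 0.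
Proof.
case: eqP => [->|/eqP cd].
  rewrite -sumr_const; apply: ler_sum => x _.
  by move: (qchar_bound (x + d)); nia.
rewrite (reindex_inj (addIr (- c))) /=.
under eq_bigr do rewrite subrK -addrA.
by rewrite qchar_correlation // addrC subr_eq0 eq_sym.
Qed.
End QuadraticCharacter.

(** * Legendre symbol sums *)

Lemma natr_Fp_eq p m n : prime p -> (m%:R == n%:R :> 'F_p) = (m == n %[mod p]).
Proof. by move=> pp; rewrite -val_eqE /= !val_Fp_nat. Qed.

Lemma Fp_two_neq0 p : prime p -> odd p -> 2%:R != 0 :> 'F_p.
Proof.
move=> pp op; rewrite -[0]/(0%:R) natr_Fp_eq // mod0n -/(dvdn p 2).
by rewrite gtnNdvd // ltn_neqAle prime_gt1 // andbT; apply: contraTneq op => <-.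
Qed.

Lemma square_existsP (F : finFieldType) (x : F) :
  reflect (exists y, y ^+ 2 = x) [exists y : F, y ^+ 2 == x].
Proof. by apply: (iffP existsP) => -[y /eqP yE]; exists y. Qed.

Lemma legendre_qchar p n : prime p -> legendre p n = qchar (n%:R : 'F_p).
Proof.
move=> pp; rewrite /legendre /qchar.
rewrite -[n%:R == 0]/(n%:R == 0%:R :> 'F_p) natr_Fp_eq // mod0n -/(dvdn p n).
case: ifP => // _.
case: (@square_existsP 'F_p n%:R) => [[y yE]|no]; case: existsP => // -[].
  have yp : (val y < p)%N by apply: leq_trans (ltn_ord y) _; rewrite Fp_cast.
  by exists (Ordinal yp); rewrite /= -natr_Fp_eq // natrM natr_Zp -expr2 yE.
move=> y yE; case: no; exists (y%:R : 'F_p).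
by apply/eqP; rewrite expr2 -natrM natr_Fp_eq.
Qed.

Lemma legendreM p a b : prime p -> odd p ->
  legendre p (a * b) = legendre p a * legendre p b.
Proof.
by move=> pp op; rewrite !legendre_qchar // natrM qcharM.
Qed.

Lemma legendre_bound p n : -1 <= legendre p n <= 1.
Proof. by rewrite /legendre; case: ifP => // _; case: ifP. Qed.

Lemma legendre_mod p n : legendre p (n %% p) = legendre p n.
Proof. by rewrite /legendre /dvdn modn_mod. Qed.

Lemma legendre_nonresidue p : prime p -> odd p -> exists c, legendre p c = -1.
Proof.
move=> pp op; have [c cE] := nonsquare_exists (Fp_two_neq0 pp op).
by exists (val c); rewrite legendre_qchar // natr_Zp.
Qed.

Lemma legendre_eq0 p n : (legendre p n == 0) = (p %| n)%N.
Proof. by rewrite /legendre; case: ifP => // _; case: ifP. Qed.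

Lemma S_sumE l p : S_sum l p = \sum_(i < l) legendre p i.+1.
Proof.
rewrite /S_sum -(big_mkord xpredT (fun i => legendre p i.+1)) /index_iota subn0.
rewrite (iotaDl 1 0) -map_comp.
by elim: (iota 0 l) => [|a s IH] /=; rewrite ?big_nil // big_cons IH.
Qed.

(** * Sums of periodic functions on the natural numbers *)

Section PeriodicSums.
Variables (f : nat -> Z) (M : nat).
Hypothesis M_gt0 : (0 < M)%N.
Hypothesis f_mod : forall n, f (n %% M) = f n.

(** Multiplication by [c] permutes the residues and negates [f]. This serves one Legendre symbol as
    well as a product of two. *)
Lemma antiperiodic_sum c : coprime c M -> (forall n, f (c * n) = - f n) ->
  \sum_(i < M) f i = 0.
Proof.
move=> cM fc.
pose g (i : 'I_M) : 'I_M := Ordinal (ltn_pmod (c * i) M_gt0).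
have g_inj : injective g.
  suff le_inj (i j : 'I_M) : (i <= j)%N -> g i = g j -> i = j.
    by move=> i j gij; case: (leqP i j) => [|/ltnW] /le_inj ij; [|symmetry]; apply: ij.
  move=> ij /(congr1 val) /= /eqP; rewrite eq_sym eqn_mod_dvd ?leq_mul //.
  rewrite -mulnBr Gauss_dvdr 1?coprime_sym // => dvd; apply: val_inj => /=.
  apply/eqP; rewrite eqn_leq ij /= -subn_eq0.
  by apply: contraLR dvd => nz; rewrite gtnNdvd ?lt0n //; have := ltn_ord j; lia.
suff : \sum_(i < M) f i = - \sum_(i < M) f i by lia.
rewrite [LHS](reindex_inj g_inj) /= -sumrN.
by apply: eq_bigr => i _; rewrite f_mod fc.
Qed.

Hypothesis f_sum0 : \sum_(i < M) f i = 0.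

Lemma periodic_partial_sum n :
  \sum_(i < n) f i.+1 = \sum_(i < n %% M) f i.+1.
Proof.
(* The sums start at 1 while a period starts at 0; the correction [f 0] cancels. *)
have tail k : \sum_(i < k) f i.+1 = \sum_(i < k.+1) f i - f 0%N.
  by rewrite big_ord_recl addrC addKr.
have period k : \sum_(i < k + M) f i = \sum_(i < k) f i.
  rewrite addnC big_split_ord /= f_sum0 add0r.
  by apply: eq_bigr => i _; rewrite -f_mod modnDl f_mod.
have periods q k : \sum_(i < q * M + k) f i.+1 = \sum_(i < k) f i.+1.
  elim: q => [|q IH]; first by rewrite mul0n.
  by rewrite -IH mulSn -addnA [(M + _)%N]addnC !tail -addSn period.
by rewrite -[RHS](periods (n %/ M)%N) -divn_eq.
Qed.

Lemma periodic_partial_sum_le n :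
  (forall i, f i <= 1) -> \sum_(i < n) f i.+1 <= M%:R.
Proof.
move=> f1; rewrite periodic_partial_sum.
apply: (@le_trans _ _ (\sum_(i < n %% M) 1)); first exact: ler_sum.
by rewrite sumr_const card_ord ler_nat ltnW ?ltn_pmod.
Qed.
End PeriodicSums.

Lemma sum_legendre p : prime p -> odd p -> \sum_(i < p) legendre p i = 0.
Proof.
move=> pp op; have [c cE] := legendre_nonresidue pp op.
apply: (antiperiodic_sum (prime_gt0 pp) (legendre_mod p) (c := c)).
  by rewrite coprime_sym prime_coprime // -legendre_eq0 cE.
by move=> n; rewrite legendreM // cE mulN1r.
Qed.

(** By the Chinese remainder theorem some [d] is a nonresidue mod [p] and 1 mod [q]; multiplying by
    it negates the product of symbols. *)
Lemma sum_legendre_mul p q : prime p -> odd p -> prime q -> odd q -> p != q ->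
  \sum_(i < p * q) legendre p i * legendre q i = 0.
Proof.
move=> pp op pq oq neq; have [c cE] := legendre_nonresidue pp op.
have copq : coprime p q by rewrite prime_coprime // dvdn_prime2.
pose d := chinese p q c 1.
have dp : legendre p d = -1 by rewrite -legendre_mod chinese_modl // legendre_mod.
have dq : legendre q d = 1.
  rewrite -legendre_mod chinese_modr // legendre_mod legendre_qchar //.
  by rewrite -(expr1n _ 2) qchar_sqr ?oner_eq0.
apply: (@antiperiodic_sum (fun i => legendre p i * legendre q i) _ _ _ d).
- by rewrite muln_gt0 !prime_gt0.
- move=> n; congr (_ * _).
    by rewrite -legendre_mod modn_dvdm ?dvdn_mulr // legendre_mod.
  by rewrite -legendre_mod modn_dvdm ?dvdn_mull // legendre_mod.
- by rewrite coprimeMr ![coprime d _]coprime_sym !prime_coprime // -!legendre_eq0 dp dq.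
- by move=> n; rewrite !legendreM // dp dq mulN1r mul1r mulNr.
Qed.

(** * Mean square of window sums modulo a prime *)

Section Windows.
Variables p h : nat.
Hypotheses (p_prime : prime p) (p_odd : odd p).

Let window (s : 'F_p) : Z := \sum_(i < h) qchar (s + i.+1%:R).

Lemma sum_Fp (G : 'F_p -> Z) : \sum_(x : 'F_p) G x = \sum_(i < p) G i%:R.
Proof.
have -> : \sum_(x : 'F_p) G x = \sum_(x : 'F_p) G (val x)%:R.
  by apply: eq_bigr => x _; rewrite natr_Zp.
have castE n (H : nat -> Z) : n = p -> \sum_(i < n) H i = \sum_(i < p) H i.
  by move=> ->.
exact: (castE _ (fun i => G i%:R) (Fp_cast p_prime)).
Qed.

(** Opening the square gives [h] diagonal correlations of at most [p] each; the others are not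
    positive, since [h <= p] keeps distinct shifts distinct mod [p]. *)
Lemma sum_window_sqr : (h <= p)%N -> \sum_s window s ^+ 2 <= (h * p)%:R.
Proof.
move=> hp.
under eq_bigr => s _ do rewrite expr2 big_distrlr /=.
rewrite exchange_big /= natrM -[h in leRHS]card_ord mulr_natl -sumr_const.
apply: ler_sum => i _; rewrite exchange_big /= (bigD1 i) //=.
rewrite -[leRHS]addr0 lerD //.
  have := qchar_autocorrelation (Fp_two_neq0 p_prime p_odd) i.+1%:R i.+1%:R.
  by rewrite eqxx card_Fp.
rewrite -oppr_ge0 -sumrN; apply: sumr_ge0 => j ji.
rewrite oppr_ge0.
have := qchar_autocorrelation (Fp_two_neq0 p_prime p_odd) i.+1%:R j.+1%:R.
rewrite natr_Fp_eq //.
case: eqP => // /eqP; rewrite -addn1 -[j.+1]addn1 eqn_modDr.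
rewrite !modn_small ?(leq_trans (ltn_ord _)) //.
by move=> /eqP/val_inj ij; rewrite ij eqxx in ji.
Qed.

(** Sliding the window by one adds one symbol and drops one, a change of at most 2. *)
Lemma window_ge s : S_sum h p - 2 * s%:R <= window s%:R.
Proof.
have windowE t : window t%:R = \sum_(i < h) legendre p (t + i.+1)%N.
  by apply: eq_bigr => i _; rewrite legendre_qchar // natrD.
elim: s => [|s]; first by rewrite mulr0 subr0 S_sumE windowE.
rewrite !windowE => IH.
have E : \sum_(i < h) legendre p (s + i.+1) + legendre p (s + h.+1) =
   legendre p s.+1 + \sum_(i < h) legendre p (s.+1 + i.+1).
  rewrite -(big_ord_recr h (fun i => legendre p (s + i.+1))) big_ord_recl addn1.
  by congr (_ + _); apply: eq_bigr => i _; rewrite addSnnS.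
have := legendre_bound p s.+1; have := legendre_bound p (s + h.+1).
rewrite -natr1; lia.
Qed.

(** The first [n] windows have sum at least [h / (2m)], so the mean square gives
    [n * h^2 <= 4 * m^2 * h * p]; then [h <= 4 * m * n] concludes. *)
Lemma biased_window_length m : (0 < h <= p)%N -> (0 < m)%N ->
  h%:R <= m%:R * S_sum h p -> (h ^ 2 <= 16 * m ^ 3 * p)%N.
Proof.
move=> /andP[h0 hp] m0 bias.
(* For starts [s <= h / (4m)] the loss [2s] is at most half of [h / m]; [n <= p] makes these starts
   distinct mod [p]. *)
pose n := (h %/ (4 * m)).+1.
have np : (n <= p)%N by rewrite /n ltn_divLR ?muln_gt0 //; nia.
have hn : (h <= n * (4 * m))%N by rewrite ltnW // -ltn_divLR ?muln_gt0.
have big_window (s : nat) : (s < n)%N -> (h ^ 2)%:R <= (4 * m ^ 2)%:R * window s%:R ^+ 2.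
  rewrite ltnS leq_divRL ?muln_gt0 // => sn.
  have : h%:R <= 2 * m%:R * window s%:R.
    have := ler_wpM2l (ler0n Z (2 * m)) (window_ge s).
    by nia.
  move=> le_h; rewrite natrX natrM natrX.
  have -> : 4%:R * m%:R ^+ 2 * window s%:R ^+ 2 = (2 * m%:R * window s%:R) ^+ 2 by ring.
  by rewrite lerXn2r // nnegrE ?(le_trans _ le_h) ?ler0n.
suff : (h * (h ^ 2) <= h * (16 * m ^ 3 * p))%N by rewrite leq_pmul2l.
have : (n * h ^ 2)%:R <= (4 * m ^ 2 * (h * p))%:R :> Z.
  rewrite natrM -[n in leLHS]card_ord mulr_natl -sumr_const natrM.
  apply: le_trans (ler_wpM2l _ (sum_window_sqr hp)); last by rewrite ler0n.
  rewrite sum_Fp mulr_sumr (big_ord_widen _ (fun _ => (h ^ 2)%:R) np) big_mkcond.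
  apply: ler_sum => i _; case: ifP => [/big_window //|_].
  by rewrite mulr_ge0 ?sqr_ge0 ?ler0n.
rewrite ler_nat => le1.
apply: leq_trans (leq_mul hn (leqnn _)) _; nia.
Qed.
End Windows.

(** Complete periods contribute 0, so the sum is at most [r = l %% p]. Hence [l <= m * r], and
    passing from [r^2] to [l^2] costs the extra [m^2]. *)
Lemma biased_length p l m : prime p -> odd p -> (0 < m)%N ->
  l%:R <= m%:R * S_sum l p -> (l ^ 2 <= 16 * m ^ 5 * p)%N.
Proof.
move=> pp op m0 bias.
have p0 := prime_gt0 pp.
have SE : S_sum l p = S_sum (l %% p) p.
  by rewrite !S_sumE (periodic_partial_sum (legendre_mod p)) ?sum_legendre.
have Sle h : S_sum h p <= h%:R.
  rewrite S_sumE -[h in leRHS]card_ord -sumr_const; apply: ler_sum => i _.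
  by case/andP: (legendre_bound p i.+1).
have lr : (l <= m * (l %% p))%N.
  by rewrite -(ler_nat Z) natrM (le_trans bias) // SE ler_wpM2l.
have [l0|r0] := posnP (l %% p); first by move: lr; rewrite l0 muln0 leqn0 => /eqP ->.
have := @biased_window_length p (l %% p) pp op m.
rewrite r0 ltnW ?ltn_pmod //= -SE => /(_ isT m0) H.
have {}H : ((l %% p) ^ 2 <= 16 * m ^ 3 * p)%N.
  by apply: H; apply: le_trans bias; rewrite ler_nat leq_mod.
have := leq_mul lr lr; have := leq_mul (leqnn (m ^ 2)) H.
set r := (l %% p)%N in H *; nia.
Qed.

(** * The dual large sieve *)

(** Cauchy-Schwarz, by summing [(a s - a t)^2 >= 0] over all pairs. *)
Lemma sqr_sum_le (T : finType) (a : T -> Z) :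
  (\sum_t a t) ^+ 2 <= #|T|%:R * \sum_t a t ^+ 2.
Proof.
suff : 2 * (\sum_t a t) ^+ 2 <= 2 * (#|T|%:R * \sum_t a t ^+ 2) by lia.
have -> : 2 * (\sum_t a t) ^+ 2 = \sum_s \sum_t 2 * (a s * a t).
  rewrite expr2 big_distrlr /= mulr_sumr.
  by apply: eq_bigr => s _; rewrite mulr_sumr.
have -> : 2 * (#|T|%:R * \sum_t a t ^+ 2) = \sum_s \sum_t (a s ^+ 2 + a t ^+ 2).
  under [RHS]eq_bigr => s _ do rewrite big_split /= sumr_const.
  rewrite big_split /= sumr_const sumrMnl -(mulr_natl (\sum_t _)); ring.
apply: ler_sum => s _; apply: ler_sum => t _.
by have := sqr_ge0 (a s - a t); nia.
Qed.

Lemma sumr_const_seq (I : Type) (V : nmodType) (s : seq I) (x : V) :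
  \sum_(i <- s) x = x *+ size s.
Proof. by rewrite big_const_seq count_predT iter_addr_0. Qed.

Section DualLargeSieve.
Variables (B : seq nat) (X : nat).
Hypothesis B_uniq : uniq B.
Hypothesis B_prime : forall p, p \in B -> [&& prime p, odd p & p <= X]%N.

Let char_sum n : Z := \sum_(p <- B) legendre p n.

(** For [p != q] only an incomplete period modulo [p * q <= X^2] survives. *)
Lemma sum_legendre_mul_le p q N : p \in B -> q \in B ->
  \sum_(i < N) legendre p i.+1 * legendre q i.+1 <=
  (if p == q then N%:R else 0) + (X ^ 2)%:R.
Proof.
move=> /B_prime/and3P[pp op pX] /B_prime/and3P[pq oq qX].
have bound i : legendre p i * legendre q i <= 1.
  by have := legendre_bound p i; have := legendre_bound q i; nia.
case: eqP => [_|/eqP neq].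
  rewrite -[leLHS]addr0 lerD ?ler0n // -[N in leRHS]card_ord -sumr_const.
  by apply: ler_sum => i _.
rewrite add0r.
apply: le_trans (periodic_partial_sum_le (M := p * q) _ _ _ N bound) _.
- by rewrite muln_gt0 !prime_gt0.
- move=> n; congr (_ * _).
    by rewrite -legendre_mod modn_dvdm ?dvdn_mulr // legendre_mod.
  by rewrite -legendre_mod modn_dvdm ?dvdn_mull // legendre_mod.
- exact: sum_legendre_mul.
by rewrite ler_nat -mulnn leq_mul.
Qed.

Lemma dual_large_sieve N :
  \sum_(i < N) char_sum i.+1 ^+ 2 <= (size B * N + size B ^ 2 * X ^ 2)%:R.
Proof.
under eq_bigr => i _ do rewrite expr2 big_distrlr /=.
rewrite exchange_big /=.
have -> : (size B * N + size B ^ 2 * X ^ 2)%:R =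
    \sum_(p <- B) (N%:R + (size B * X ^ 2)%:R) :> Z.
  by rewrite -natrD sumr_const_seq -mulrnA; congr _%:R; nia.
rewrite [leLHS]big_seq [leRHS]big_seq; apply: ler_sum => p pB.
rewrite exchange_big /=.
have -> : N%:R + (size B * X ^ 2)%:R =
    \sum_(q <- B) ((if p == q then N%:R else 0) + (X ^ 2)%:R) :> Z.
  rewrite big_split /= sumr_const_seq natrM mulr_natl; congr (_ + _).
  by rewrite (bigD1_seq p) //= eqxx big1 ?addr0 // => q; rewrite eq_sym => /negPf ->.
rewrite [leLHS]big_seq [leRHS]big_seq; apply: ler_sum => q qB.
exact: sum_legendre_mul_le.
Qed.

Variables (k l D : nat).

Let tuple_prod (t : {ffun 'I_k -> 'I_l}) := (\prod_i (t i).+1)%N.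

Hypothesis tuple_count :
  forall n, (0 < n <= l ^ k)%N -> (#|[pred t | tuple_prod t == n]| <= D)%N.

Lemma S_sum_exp p : prime p -> odd p ->
  S_sum l p ^+ k = \sum_(t : {ffun 'I_k -> 'I_l}) legendre p (tuple_prod t).
Proof.
move=> pp op; rewrite S_sumE -[in LHS](card_ord k) -prodr_const.
rewrite bigA_distr_bigA /=; apply: eq_bigr => t _.
rewrite (big_morph (legendre p) (fun a b => legendreM a b pp op) (id1 := 1)) //.
by rewrite legendre_qchar // -(expr1n _ 2) qchar_sqr ?oner_eq0.
Qed.

(** The tuples are grouped by their product, and [D] bounds the size of each group. *)
Lemma sum_tuple_prod_le (G : nat -> Z) : (forall n, 0 <= G n) ->
  \sum_(t : {ffun 'I_k -> 'I_l}) G (tuple_prod t) <= D%:R * \sum_(i < l ^ k) G i.+1.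
Proof.
move=> G0.
have prod_gt0 t : (0 < tuple_prod t)%N by apply: prodn_gt0.
have prod_le t : (tuple_prod t <= l ^ k)%N.
  rewrite -[k in (_ ^ k)%N]card_ord -prod_nat_const.
  by apply: leq_prod => i _; apply: ltn_ord.
apply: (@le_trans _ _ (\sum_(t : {ffun 'I_k -> 'I_l})
    \sum_(i < l ^ k | tuple_prod t == i.+1) G i.+1)).
  apply: ler_sum => t _.
  have ti : ((tuple_prod t).-1 < l ^ k)%N by rewrite prednK.
  rewrite (bigD1 (Ordinal ti)) /= ?prednK //.
  by rewrite lerDl sumr_ge0.
rewrite (exchange_big_dep xpredT) //= mulr_sumr; apply: ler_sum => i _.
by rewrite sumr_const -[leLHS]mulr_natl ler_wpM2r // ler_nat tuple_count //= ltn_ord.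
Qed.

(** Bias bounds [b * N] by [m^k] times the sum of [char_sum] over all tuples. Cauchy-Schwarz over
    the [N] tuples and the sieve give [b^2 * N^2 <= m^(2k) * N * D * (b * N + b^2 * X^2)]. *)
Lemma few_biased_primes m :
  (forall p, p \in B -> l%:R <= m%:R * S_sum l p) ->
  (0 < m)%N -> (0 < l)%N ->
  (2 * m ^ (2 * k) * D * X ^ 2 <= l ^ k)%N ->
  (size B <= 2 * m ^ (2 * k) * D)%N.
Proof.
move=> bias m0 l0 large.
set N := (l ^ k)%N in large *; set b := size B.
have N0 : (0 < N)%N by rewrite expn_gt0 l0.
have lower : (b * N)%:R <=
    (m ^ k)%:R * \sum_(t : {ffun 'I_k -> 'I_l}) char_sum (tuple_prod t).
  rewrite /char_sum exchange_big /= mulr_sumr.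
  rewrite natrM mulr_natl -sumr_const_seq.
  rewrite [leLHS]big_seq [leRHS]big_seq; apply: ler_sum => p pB.
  have /and3P[pp op _] := B_prime pB.
  (* Bias makes [m * S] nonnegative, so [k]-th powers keep the order for either parity of [k]. *)
  rewrite -S_sum_exp // natrX -exprMn /N natrX lerXn2r ?nnegrE ?ler0n ?bias //.
  exact: le_trans (bias p pB).
have : (b * N)%:R ^+ 2 <= ((m ^ k) ^ 2 * (N * (D * (b * N + b ^ 2 * X ^ 2))))%:R :> Z.
  apply: (@le_trans _ _ (((m ^ k)%:R *
      \sum_(t : {ffun 'I_k -> 'I_l}) char_sum (tuple_prod t)) ^+ 2)).
    by rewrite lerXn2r ?nnegrE ?ler0n // (le_trans _ lower) ?ler0n.
  rewrite exprMn [leRHS]natrM (natrX _ (m ^ k) 2) ler_wpM2l ?sqr_ge0 //.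
  apply: le_trans (sqr_sum_le _) _.
  rewrite card_ffun !card_ord natrM ler_wpM2l ?ler0n //.
  apply: le_trans (sum_tuple_prod_le (G := fun n => char_sum n ^+ 2) _) _ => [n|].
    exact: sqr_ge0.
  by rewrite natrM ler_wpM2l ?ler0n ?dual_large_sieve.
rewrite -natrX ler_nat -expnM mulnC [(k * 2)%N]mulnC.
set A := (m ^ (2 * k))%N in large *.
have [-> //|b0] := posnP b.
move=> H.
have {}H : (b * N * N <= A * (D * (N + b * X ^ 2)) * N)%N.
  rewrite -(@leq_pmul2l b) //; apply: leq_trans _ (leq_trans H _); nia.
move: H; rewrite leq_pmul2r // => H.
(* By [large], [A * D * b * X^2] is at most half of [b * N] and is absorbed on the left. *)
have {}H : (b * N <= 2 * A * D * N)%N by nia.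
by rewrite leq_pmul2r in H.
Qed.
End DualLargeSieve.

(** * The divisor bound *)

Local Open Scope nat_scope.

(** The [q]-th power of [a.+1 <= q * 2 ^ (a.+1 %/ q)]. It serves the divisor bound and later absorbs
    a logarithm. *)
Lemma succ_exp_le q a : 0 < q -> a.+1 ^ q <= 2 * q ^ q * 2 ^ a.
Proof.
move=> q0.
have le1 : a.+1 <= q * 2 ^ (a.+1 %/ q).
  apply: leq_trans (ltnW (ltn_ceil a.+1 q0)) _.
  by rewrite mulnC leq_mul // ltn_expl.
rewrite -(leq_exp2r _ _ q0) in le1; apply: leq_trans le1 _.
rewrite expnMn -expnM mulnAC -expnS mulnC leq_mul2r leq_exp2l //.
by rewrite leq_divM orbT.
Qed.

(** A divisor is determined by its valuation at [y] and its part prime to [y]. Allowing any [y] lets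
    the next induction step through all integers. *)
Lemma size_divisors_partn y n : 0 < n ->
  size (divisors n) <= (logn y n).+1 * size (divisors n`_y^').
Proof.
move=> n0.
pose f e := (logn y e, e`_y^').
pose s := [seq (a, e) | a <- iota 0 (logn y n).+1, e <- divisors n`_y^'].
have -> : (logn y n).+1 * size (divisors n`_y^') = size s.
  by rewrite size_allpairs size_iota.
rewrite -(size_map f); apply: uniq_leq_size.
  rewrite map_inj_in_uniq ?divisors_uniq // => d e.
  rewrite -!dvdn_divisors // => dn en [logE partE].
  by rewrite -(partnC y (dvdn_gt0 n0 dn)) -(partnC y (dvdn_gt0 n0 en)) !p_part logE partE.
move=> _ /mapP[d + ->]; rewrite -dvdn_divisors // => dn.
apply: allpairs_f; last by rewrite -dvdn_divisors ?part_gt0 // partn_dvd.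
by rewrite mem_iota ltnS dvdn_leq_log.
Qed.

(** With [a = logn y n], a prime [y >= 2^q] is free because [(a+1)^q <= 2^(a*q) <= y^a]; each of the
    finitely many smaller ones costs at most a factor [K]. *)
Lemma size_divisors_le q : 0 < q ->
  exists C, forall n, 0 < n -> size (divisors n) ^ q <= C * n.
Proof.
move=> q0; pose K := 2 * q ^ q.
have K0 : 0 < K by rewrite muln_gt0 expn_gt0 q0.
(* Here [y] exceeds all prime factors of [n], and [minn y (2 ^ q)] counts the integers that may cost
   a [K]. *)
suff bound y n : 0 < n -> (forall p, p \in primes n -> p < y) ->
    size (divisors n) ^ q <= K ^ minn y (2 ^ q) * n.
  exists (K ^ (2 ^ q)) => n n0.
  apply: leq_trans (bound n.+1 n n0 _) _ => [p|].
    by rewrite mem_primes ltnS => /and3P[_ _]; apply: dvdn_leq.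
  by rewrite leq_mul2r leq_pexp2l ?geq_minr ?orbT.
elim: y n => [|y IH] n n0 smooth.
  have -> : n = 1.
    apply/eqP; rewrite eqn_leq n0 andbT leqNgt; apply/negP => n1.
    have := smooth _ (_ : pdiv n \in primes n); rewrite ltn0.
    by rewrite mem_primes pdiv_prime // n0 pdiv_dvd => /(_ isT).
  by rewrite exp1n muln1 expn_gt0 K0.
pose m := n`_y^'; pose a := logn y n.
have m0 : 0 < m by apply: part_gt0.
have nE : n = y ^ a * m by rewrite -p_part partnC.
have {}IH : size (divisors m) ^ q <= K ^ minn y (2 ^ q) * m.
  apply: IH => // p; rewrite mem_primes => /and3P[pp _ pm].
  have : p < y.+1.
    by apply: smooth; rewrite mem_primes pp n0 (dvdn_trans pm) ?dvdn_part.
  rewrite ltnS leq_eqVlt => /predU1P[py|//].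
  by have /(pnatP _ m0)/(_ p pp pm) := part_pnat (y^') n; rewrite py !inE eqxx.
have ya : 0 < a -> 1 < y by rewrite logn_gt0 mem_primes => /and3P[/prime_gt1].
have le1 : size (divisors n) ^ q <= a.+1 ^ q * size (divisors m) ^ q.
  by rewrite -expnMn leq_exp2r ?size_divisors_partn.
apply: leq_trans le1 (leq_trans (leq_mul (leqnn _) IH) _).
rewrite [in leqRHS]nE [leqLHS]mulnA [leqRHS]mulnA leq_mul2r; apply/orP; right.
have [yq|qy] := ltnP y (2 ^ q).
  rewrite !(minn_idPl _) ?(ltnW yq) // expnS mulnAC leq_mul2r; apply/orP; right.
  apply: leq_trans (succ_exp_le a q0) _; rewrite leq_mul2l; apply/orP; right.
  by have [->//|a0] := posnP a; rewrite leq_exp2r // ya.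
rewrite !(minn_idPr _) ?(leqW qy) // mulnC leq_mul2l; apply/orP; right.
have [->|a0] := posnP a; first by rewrite exp1n.
apply: (@leq_trans ((2 ^ a) ^ q)); first by rewrite leq_exp2r // ltn_expl.
by rewrite -expnM mulnC expnM leq_exp2r.
Qed.

Lemma card_tuple_prod_le k l n : 0 < n ->
  #|[pred t : {ffun 'I_k -> 'I_l} | \prod_i (t i).+1 == n]| <= size (divisors n) ^ k.
Proof.
move=> n0; pose R := [pred j : 'I_l | j.+1 %| n].
have RD : #|R| <= size (divisors n).
  rewrite cardE -(size_map (fun j : 'I_l => j.+1)); apply: uniq_leq_size.
    by rewrite map_inj_uniq ?enum_uniq // => i j [] /val_inj.
  by move=> _ /mapP[j + ->]; rewrite mem_enum inE -dvdn_divisors.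
apply: (@leq_trans (#|R| ^ k)); last first.
  by case: (posnP k) => [->//|k0]; rewrite leq_exp2r.
rewrite -[k in _ ^ k]card_ord -card_ffun_on; apply/subset_leq_card/subsetP => t.
rewrite !inE => /eqP tn; apply/ffun_onP => i; rewrite inE -tn.
by rewrite (bigD1 i) //= dvdn_mulr.
Qed.

(** * Counting biased pairs *)

Lemma bigmax_exp_le (I : Type) (r : seq I) (P : pred I) (F : I -> nat) q c :
  0 < q -> (forall i, P i -> F i ^ q <= c) -> (\max_(i <- r | P i) F i) ^ q <= c.
Proof.
move=> q0; apply: (big_ind (fun x => x ^ q <= c)); first by rewrite exp0n.
by move=> a b ac bc; case: (leqP a b).
Qed.

Definition odd_prime_list (X : nat) (B : seq nat) :=
  uniq B /\ forall p, p \in B -> [&& prime p, odd p & p <= X].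

Section BiasedPrimes.
Variables (k m q : nat).
Hypotheses (k_gt0 : 0 < k) (m_gt0 : 0 < m) (q_gt0 : 0 < q).

(** As [q] is arbitrary, this is the bound [X^o(1)] for a fixed [l]. *)
Lemma biased_primes_count : exists C, forall X l B, odd_prime_list X B ->
  (forall p, p \in B -> (l%:R <= m%:R * S_sum l p)%R) ->
  0 < l -> X ^ 3 <= l ^ k -> size B ^ q <= C * X.
Proof.
(* [D] is the [k]-th power of a divisor count at some [n <= (M * X)^k]; the exponent [k * q * k]
   makes the bound for [D ^ q] linear in [X]. *)
have [C tauC] : exists C, forall n, 0 < n -> size (divisors n) ^ (k * q * k) <= C * n.
  by apply: size_divisors_le; rewrite !muln_gt0 k_gt0 q_gt0.
have C1 : 0 < C by have := tauC 1 isT; rewrite exp1n muln1.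
have [M ME] : exists M, M = 16 * m ^ 5 by eexists.
pose A := 2 * m ^ (2 * k).
exists (A ^ q * (C * M)) => X l B [B_uniq B_prime] bias l0 large.
case BE : B => [|p0 B']; first by rewrite exp0n.
rewrite -BE.
have lX : l <= M * X.
  have p0B : p0 \in B by rewrite BE mem_head.
  have /and3P[pp op pX] := B_prime _ p0B.
  apply: (@leq_trans (l ^ 2)); first by rewrite -mulnn leq_pmull.
  apply: leq_trans (biased_length pp op m_gt0 (bias _ p0B)) _.
  by rewrite ME leq_mul2l pX orbT.
pose D := \max_(n < (l ^ k).+1 | 0 < n) size (divisors n) ^ k.
have DX : D ^ q <= C * M * X.
  apply: bigmax_exp_le => // n n0.
  rewrite -(leq_exp2r _ _ k_gt0) -!expnM ?mulnA.
  apply: leq_trans (tauC _ n0) _.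
  apply: (@leq_trans (C ^ k * (M * X) ^ k)); last by rewrite -expnMn mulnA.
  apply: leq_mul; first by rewrite -{1}(expn1 C) leq_pexp2l.
  have nl : n <= l ^ k by rewrite -ltnS.
  by apply: leq_trans nl _; rewrite leq_exp2r.
have BAD : size B <= A * D.
  (* If the sieve condition fails, [X^3 <= l^k < A * D * X^2] forces [X < A * D], and [size B <= X]
     suffices. *)
  have [AD|AD] := leqP (A * D * X ^ 2) (l ^ k).
    apply: (@few_biased_primes B X B_uniq B_prime k l D _ m) => //.
    move=> n /andP[n0 nl]; apply: leq_trans (card_tuple_prod_le k l n0) _.
    have nS : n < (l ^ k).+1 by [].
    exact: (leq_bigmax_cond (Ordinal nS)).
  have BX : size B <= X.
    rewrite -[X](size_iota 1); apply: uniq_leq_size => // p /B_prime/and3P[pp _ pX].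
    by rewrite mem_iota add1n ltnS prime_gt0.
  apply: leq_trans BX _; move: (leq_ltn_trans large AD).
  rewrite expnSr mulnC [A * D * _]mulnC.
  case: (posnP X) => [->//|X0].
  by rewrite [X in X < _]mulnC ltn_pmul2l ?expn_gt0 ?X0 // => /ltnW.
apply: (@leq_trans ((A * D) ^ q)); first by rewrite leq_exp2r.
by rewrite expnMn -mulnA leq_mul2l DX orbT.
Qed.

End BiasedPrimes.

(** Only [l << X^(1/2)] can have biased primes, and each has [<< X^(1/(2r))] of them. *)
Lemma biased_pairs_count k m r : 0 < k -> 0 < m -> 0 < r ->
  exists C, forall X P s, odd_prime_list X P -> uniq s ->
  (forall l, l \in s -> 0 < l /\ X ^ 3 <= l ^ k) ->
  (\sum_(l <- s) count (fun p => (l%:R <= m%:R * S_sum l p)%R) P) ^ (2 * r)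
    <= C * X ^ r.+1.
Proof.
move=> k0 m0 r0.
have q0 : 0 < 2 * r by rewrite muln_gt0.
have [C countC] := biased_primes_count k0 m0 q0.
have [M ME] : exists M, M = 16 * m ^ 5 by eexists.
exists (M ^ r * C) => X P s [P_uniq P_prime] s_uniq s_large.
pose biased l p := (l%:R <= m%:R * S_sum l p)%R.
pose b l := count (biased l) P.
pose s' := [seq l <- s | has (biased l) P].
have -> : \sum_(l <- s) count (biased l) P = \sum_(l <- s') b l.
  rewrite big_filter [RHS]big_mkcond; apply: eq_bigr => l _.
  by rewrite /b has_count; case: posnP.
pose L := \max_(l <- s' | l \in s') l; pose T := \max_(l <- s | l \in s) b l.
have LX : L ^ 2 <= M * X.
  apply: bigmax_exp_le => // l; rewrite mem_filter => /andP[/hasP[p pP biasp] ls].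
  have /and3P[pp op pX] := P_prime _ pP.
  by apply: leq_trans (biased_length pp op m0 biasp) _; rewrite ME leq_mul2l pX orbT.
have TX : T ^ (2 * r) <= C * X.
  apply: bigmax_exp_le => // l ls; rewrite /b -size_filter.
  have [l0 lX] := s_large _ ls; apply: (countC X l) => //.
    split; first exact: filter_uniq.
    by move=> p; rewrite mem_filter => /andP[_ /P_prime].
  by move=> p; rewrite mem_filter => /andP[].
have sL : size s' <= L.
  rewrite -[L](size_iota 1); apply: uniq_leq_size; first exact: filter_uniq.
  move=> l ls; rewrite mem_iota add1n ltnS.
  have -> : 0 < l by move: ls; rewrite mem_filter => /andP[_ /s_large[]].
  by rewrite /L -big_filter (@leq_bigmax_seq _ _ xpredT id) // mem_filter ls.
have sumT : \sum_(l <- s') b l <= size s' * T.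
  rewrite -sum1_size big_distrl /= big_seq [leqRHS]big_seq; apply: leq_sum => l.
  rewrite mul1n mem_filter => /andP[_ ls].
  by rewrite /T -big_filter (@leq_bigmax_seq _ _ xpredT b) // mem_filter ls.
apply: (@leq_trans ((L * T) ^ (2 * r))).
  by rewrite leq_exp2r // (leq_trans sumT) // leq_mul2r sL orbT.
rewrite expnMn.
apply: leq_trans (leq_mul (_ : L ^ (2 * r) <= (M * X) ^ r) TX) _.
  by rewrite expnM leq_exp2r.
by rewrite expnMn expnS; lia.
Qed.

(** * A Chebyshev lower bound *)

(** Pascal's rule and symmetry give a factor of at least 2 per step. *)
Lemma central_binomial_ge n : 2 ^ n <= 'C(n.*2, n).
Proof.
elim: n => // n IH; rewrite expnS doubleS.
rewrite binS -[X in _ <= X + _]bin_sub; last by rewrite -addnn; lia.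
have -> : n.*2.+1 - n.+1 = n by rewrite subSS -addnn addnK.
by rewrite addnn -mul2n leq_mul2l /= (leq_trans IH) // leq_bin2l.
Qed.

(** In Legendre's formula the [k]-th term, [2n %/ p^k] minus twice [n %/ p^k], is 0 or 1, and is 0
    once [p^k > 2n]. *)
Lemma central_binomial_logn p n : prime p -> logn p 'C(n.*2, n) <= trunc_log p n.*2.
Proof.
move=> pp; have p1 := prime_gt1 pp.
have [->|n0] := posnP n; first by rewrite bin0 logn1.
have nn : n <= n.*2 by rewrite -addnn leq_addr.
have /(congr1 (logn p)) := bin_fact nn.
have -> : n.*2 - n = n by rewrite -addnn addnK.
rewrite !lognM ?muln_gt0 ?fact_gt0 ?bin_gt0 //.
rewrite !logn_fact //.
have -> : \sum_(1 <= k < n.+1) n %/ p ^ k = \sum_(1 <= k < n.*2.+1) n %/ p ^ k.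
  rewrite [RHS](big_cat_nat (n := n.+1)) //= [X in _ + X]big_nat.
  rewrite [X in _ + X]big1 ?addn0 // => k /andP[nk _].
  by rewrite divn_small // (leq_trans nk) // ltnW // ltn_expl.
have : \sum_(1 <= k < n.*2.+1) n.*2 %/ p ^ k <=
    \sum_(1 <= k < n.*2.+1) (n %/ p ^ k + n %/ p ^ k + (k <= trunc_log p n.*2)).
  apply: leq_sum => k _; have pk0 : 0 < p ^ k by rewrite expn_gt0 prime_gt0.
  have [kt|tk] := leqP k (trunc_log p n.*2).
    by rewrite -addnn divnD // leq_add2l leq_b1.
  rewrite divn_small // (leq_trans (trunc_log_ltn _ p1)) // leq_pexp2l ?prime_gt0 //.
rewrite !big_split /=.
have : \sum_(1 <= k < n.*2.+1) (k <= trunc_log p n.*2) <= trunc_log p n.*2.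
  set t := trunc_log _ _.
  apply: (@leq_trans (\sum_(1 <= k < t.+1) 1)); last first.
    by rewrite sum_nat_const_nat subn1 muln1.
  have tn : t.+1 <= n.*2.+1.
    by rewrite ltnS (leq_trans (ltnW (ltn_expl t p1))) // trunc_logP // double_gt0.
  rewrite (big_cat_nat (n := t.+1)) //= [X in _ + X]big_nat [X in _ + X]big1 ?addn0.
    by apply: leq_sum => k _; rewrite leq_b1.
  by move=> k /andP[tk _]; rewrite leqNgt tk.
lia.
Qed.

Definition odd_primes n := [seq p <- iota 0 n.+1 | odd p && prime p].

(** Each prime power in the factorisation is at most [2n <= X]; the extra 1 in the exponent accounts
    for the prime 2. *)
Lemma central_binomial_le n X : 0 < n -> n.*2 <= X ->
  'C(n.*2, n) <= X ^ (size (odd_primes X)).+1.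
Proof.
move=> n0 nX; set c := 'C(n.*2, n).
have c0 : 0 < c by rewrite bin_gt0 -addnn leq_addr.
have X0 : 0 < X by apply: leq_trans nX; rewrite double_gt0.
have part_le p : p \in primes c -> p ^ logn p c <= X.
  rewrite mem_primes => /andP[pp _]; apply: leq_trans nX.
  apply: leq_trans (trunc_logP (prime_gt1 pp) _); last by rewrite double_gt0.
  by rewrite leq_pexp2l ?prime_gt0 ?central_binomial_logn.
rewrite [leqLHS](prod_prime_decomp c0) prime_decompE big_map /=.
apply: (@leq_trans (X ^ size (primes c))).
  rewrite -[leqRHS]iter_muln_1 -(count_predT (primes c)) -big_const_seq.
  by rewrite big_seq [leqRHS]big_seq; apply: leq_prod.
rewrite leq_pexp2l // -[_.+1]/(size (2 :: odd_primes X)).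
apply: uniq_leq_size; first exact: primes_uniq.
move=> p pc; rewrite inE mem_filter mem_iota ltnS /=.
have pX : p <= X.
  apply: leq_trans (part_le _ pc); rewrite -{1}(expn1 p).
  by rewrite leq_pexp2l ?logn_gt0 //; move: pc; rewrite mem_primes => /andP[/prime_gt0].
move: pc; rewrite mem_primes pX => /andP[pp _]; rewrite pp !andbT.
by case: (even_prime pp) => [->|->] //; rewrite orbT.
Qed.

(** A form of [pi(X) >> X^(1 - 1/q)]: the binomial bounds at [n = X./2] give [X << pi(X) log X], and
    [succ_exp_le] absorbs the logarithm. *)
Lemma size_odd_primes_ge q : 0 < q ->
  exists C, forall X, 3 <= X -> X ^ q <= C * X * size (odd_primes X) ^ q.
Proof.
move=> q0; exists (6 ^ q * (2 * q ^ q)) => X X3.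
set P := size (odd_primes X).
have P0 : 0 < P.
  have : 3 \in odd_primes X by rewrite mem_filter mem_iota add0n ltnS.
  by rewrite /P; case: (odd_primes X).
pose t := trunc_log 2 X.
have XE := odd_double_half X; have oddX : odd X <= 1 by case: (odd X).
have n0 : 0 < X./2 by lia.
have le1 : X./2 <= t.+1 * P.+1.
  rewrite -(@leq_exp2l 2) // expnM.
  apply: leq_trans (central_binomial_ge _) _.
  apply: leq_trans (central_binomial_le n0 (_ : _ <= X)) _; first by lia.
  by rewrite leq_exp2r // ltnW // trunc_log_ltn.
(* The 6 comes from [X <= 3 * X./2] and [P.+1 <= 2 * P]. *)
have le2 : X <= 6 * (t.+1 * P) by nia.
move: le2; rewrite -(leq_exp2r _ _ q0) !expnMn => le2.
apply: leq_trans le2 _.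
have le3 : t.+1 ^ q <= 2 * q ^ q * X.
  apply: leq_trans (succ_exp_le t q0) _.
  by rewrite leq_mul2l trunc_logP ?orbT // (leq_trans _ X3).
by rewrite -(mulnA (6 ^ q)) -(mulnA (6 ^ q)) leq_mul2l leq_mul2r le3 !orbT.
Qed.

(** * The tail sum *)

Lemma odd_prime_list_odd_primes X : odd_prime_list X (odd_primes X).
Proof.
split=> [|p]; first by rewrite filter_uniq ?iota_uniq.
by rewrite mem_filter mem_iota ltnS => /andP[/andP[-> ->]].
Qed.

(** Taking [r = 6] gives [T^12 << X^7], and the prime count gives [X^11 << P^12]; hence
    [T / P << X^(-1/3)]. *)
Lemma biased_pairs_ratio k m : 0 < k -> 0 < m -> exists C, forall X s,
  3 <= X -> uniq s -> (forall l, l \in s -> 0 < l /\ X ^ 3 <= l ^ k) ->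
  (\sum_(l <- s) count (fun p => (l%:R <= m%:R * S_sum l p)%R) (odd_primes X)) ^ 12
    * X ^ 4 <= C * size (odd_primes X) ^ 12.
Proof.
move=> k0 m0.
have [C pairsC] := biased_pairs_count k0 m0 (isT : 0 < 6).
have [C' primesC] := size_odd_primes_ge (isT : 0 < 12).
exists (C * C') => X s X3 s_uniq s_large.
have := pairsC X _ s (odd_prime_list_odd_primes X) s_uniq s_large.
set T := \sum_(l <- s) _; set P := size _; rewrite -[2 * 6]/12 => le1.
have X0 : 0 < X by apply: leq_trans X3.
rewrite -(@leq_pmul2r (X ^ 8)) ?expn_gt0 ?X0 //.
rewrite -mulnA -expnD.
apply: leq_trans (leq_mul le1 (primesC X X3)) _.
by rewrite -/P [X ^ 8]expnSr [X ^ _ * X]mulnC; lia.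
Qed.

(* Transfer to real numbers and conclusion *)
Delimit Scope R_scope with R.
Import Field_tac Ring_tac.
Local Close Scope nat_scope.
Local Close Scope ring_scope.
Local Open Scope R_scope.

Lemma RlebP a b : reflect (a <= b) (Rleb a b).
Proof. by rewrite /Rleb; case: Rle_dec => H; constructor. Qed.

Lemma INR_expn a b : INR (a ^ b)%N = INR a ^ b.
Proof. by elim: b => //= b IH; rewrite expnS mult_INR IH. Qed.

Lemma INR_leq a b : (a <= b)%N -> INR a <= INR b.
Proof. by move=> /ssrnat.leP; apply: le_INR. Qed.

Lemma leq_INR a b : INR a <= INR b -> (a <= b)%N.
Proof. by move=> /INR_le/ssrnat.leP. Qed.

Lemma pow_le_inv n a b : (0 < n)%N -> 0 <= a -> 0 < b -> a ^ n <= b ^ n -> a <= b.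
Proof.
move=> n0 a0 b0 le_n; apply: Rnot_lt_le => ba.
have n0' : 0 < INR n by apply: lt_0_INR; apply/ssrnat.ltP.
have := Rlt_Rpower_l b a (INR n) n0' (conj b0 ba).
by rewrite !Rpower_pow //; lra.
Qed.

Lemma odd_primes_uptoE x : 0 <= x ->
  exists X, [/\ INR X <= x, x < INR X + 1 & odd_primes_upto x = odd_primes X].
Proof.
move=> x0; have [x_lt lt_x] := archimed x.
have up0 : (0 < up x)%Z by apply: lt_IZR; lra.
have XE : Z.to_nat (up x) = (Z.to_nat (up x)).-1.+1%N by lia.
exists (Z.to_nat (up x)).-1%N; set X := (Z.to_nat (up x)).-1%N in XE *.
have INRX : INR X + 1 = IZR (up x).
  by rewrite -S_INR -XE INR_IZR_INZ Z2Nat.id //; lia.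
have Xx : INR X <= x by lra.
split=> //; first by lra.
rewrite /odd_primes_upto /odd_primes XE; apply: eq_in_filter => p.
rewrite mem_iota add0n ltnS => /= /INR_leq pX.
by rewrite (introT (RlebP _ _)) ?andbT //; lra.
Qed.

Lemma tail_partial_sumE eps y N x :
  tail_partial_sum eps y N x =
  INR (\sum_(l <- iota 1 N | ~~ Rleb (INR l) y)
         count (fun p => Rleb (eps * INR l) (IZR (S_sum l p))) (odd_primes_upto x))
  / INR (pi_odd x).
Proof.
rewrite /tail_partial_sum -big_filter; elim: filter => [|l s IH] /=.
  by rewrite big_nil /Rdiv Rmult_0_l.
by rewrite big_cons IH /P_l plus_INR /Rdiv Rmult_plus_distr_r.
Qed.

Theorem theorem2p6 (eps kappa beta : R) :
  (0 < eps <= 1)%R ->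
  (0 < kappa < 1/6)%R ->
  (0 < beta < 1/3 - 2 * kappa)%R ->
  exists (C x0 : R), forall x : R, (x0 <= x)%R ->
    forall N : nat,
      (Rabs (tail_partial_sum eps (Rpower x (1/6 - kappa)) N x)
         <= C * Rpower x (- beta))%R.
Proof.
move=> eps_bd kappa_bd beta_bd.
(* Since [1 / m < eps], [S >= eps * l] implies the integer condition [l <= m * S]. *)
have [m [m_eps m0]] : exists m : nat, / INR m < eps /\ (0 < m)%coq_nat.
  by apply: archimed_cor1; lra.
have mR0 : 0 < INR m by apply: lt_0_INR.
(* This [k] turns [l > x^(1/6 - kappa)] into [l^k >= x^3]. *)
have [k k_kappa] := INR_unbounded (3 / (1/6 - kappa)).
have a0 : 0 < 1/6 - kappa by lra.
have k3 : 3 <= (1/6 - kappa) * INR k.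
  have -> : 3 = (1/6 - kappa) * (3 / (1/6 - kappa)) by field; lra.
  by apply: Rmult_le_compat_l; lra.
have k0 : (0 < k)%N.
  by case: (k) k3 => // ; rewrite Rmult_0_r; lra.
have [C ratioC] := biased_pairs_ratio k0 (introT ssrnat.ltP m0).
(* From [x >= 4] follow [X >= 3] and [x <= 2 * X], whose fourth power yields 16. The added 1 makes
   the constant at most its own 12th power. *)
exists (16 * INR C + 1), 4 => x x4 N.
have x0 : 0 <= x by lra.
have [X [Xx xX primesE]] := odd_primes_uptoE x0.
have X3 : (3 <= X)%N by apply: leq_INR; rewrite /=; lra.
rewrite tail_partial_sumE /pi_odd primesE.
set s := iota 1 N; set y := Rpower x _; rewrite -big_filter.
set s' := filter _ _; set T := (\sum_(l <- _) _)%N; set P := size _.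
have P0 : 0 < INR P.
  apply: lt_0_INR; apply/ssrnat.ltP.
  have : (3 \in odd_primes X)%N by rewrite mem_filter mem_iota add0n ltnS.
  by rewrite /P; case: (odd_primes X).
have s_large l : l \in s' -> (0 < l)%N /\ (X ^ 3 <= l ^ k)%N.
  rewrite mem_filter mem_iota => /andP[/RlebP/Rnot_le_lt yl /andP[l0 _]].
  split=> //; apply: leq_INR; rewrite !INR_expn.
  apply: (Rle_trans _ (x ^ 3)); first by apply: pow_incr; split; [apply: pos_INR|].
  apply: (Rle_trans _ (y ^ k)); last first.
    by apply: pow_incr; split; [apply: Rlt_le; apply: exp_pos | apply: Rlt_le].
  rewrite -(Rpower_pow k y); last exact: exp_pos.
  rewrite /y Rpower_mult -(Rpower_pow 3 x); last by lra.
  by apply: Rle_Rpower; rewrite /=; lra.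
have := ratioC X s' X3 (filter_uniq _ (iota_uniq _ _)) s_large.
set T' := (\sum_(l <- _) _)%N => ratio.
have TT' : (T <= T')%N.
  apply: leq_sum => l _; apply: sub_count => p /= /RlebP bias.
  have : INR l <= INR m * IZR (S_sum l p).
    apply: (Rle_trans _ (INR m * (eps * INR l))); last first.
      by apply: Rmult_le_compat_l => //; lra.
    rewrite -Rmult_assoc -[X in X <= _]Rmult_1_l.
    apply: Rmult_le_compat_r; first exact: pos_INR.
    rewrite -(Rinv_r (INR m)); last by lra.
    by apply: Rmult_le_compat_l; lra.
  rewrite !INR_IZR_INZ -mult_IZR => /le_IZR; lia.
have {ratio}ratio : INR T ^ 12 * INR X ^ 4 <= INR C * INR P ^ 12.
  rewrite -!INR_expn -!mult_INR; apply: INR_leq; apply: leq_trans ratio.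
  by rewrite leq_mul2r leq_exp2r // TT' orbT.
pose u := INR T / INR P.
have u0 : 0 <= u.
  by apply: Rmult_le_pos; [apply: pos_INR | apply/Rlt_le/Rinv_0_lt_compat].
rewrite -/u Rabs_pos_eq //.
have c0 := pos_INR C.
have x40 : 0 < x ^ 4 by apply: pow_lt; lra.
have u12 : u ^ 12 * x ^ 4 <= 16 * INR C.
  have uX : u ^ 12 * INR X ^ 4 <= INR C.
    rewrite /u Rpow_mult_distr pow_inv.
    apply: (Rmult_le_reg_r (INR P ^ 12)); first exact: pow_lt.
    have -> : INR T ^ 12 * / INR P ^ 12 * INR X ^ 4 * INR P ^ 12 = INR T ^ 12 * INR X ^ 4.
      by field; apply: Rgt_not_eq.
    exact: ratio.
  have xX4 : x ^ 4 <= 16 * INR X ^ 4.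
    have -> : 16 * INR X ^ 4 = (2 * INR X) ^ 4 by ring.
    by apply: pow_incr; lra.
  apply: (Rle_trans _ (u ^ 12 * (16 * INR X ^ 4))).
    by apply: Rmult_le_compat_l => //; apply: pow_le.
  by lra.
(* Here [beta < 1/3 - 2 * kappa < 1/3], so a saving of [x^(-1/3)] is enough. *)
apply: (Rle_trans _ ((16 * INR C + 1) * Rpower x (- (1/3)))); last first.
  by apply: Rmult_le_compat_l; [lra | apply: Rle_Rpower; lra].
have y0 : 0 < Rpower x (- (1/3)) by apply: exp_pos.
apply: (@pow_le_inv 12) => //; first by apply: Rmult_lt_0_compat => //; lra.
rewrite Rpow_mult_distr -(Rpower_pow 12 (Rpower _ _)) // Rpower_mult.
have -> : - (1/3) * INR 12 = - INR 4 by rewrite /=; lra.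
rewrite Rpower_Ropp Rpower_pow; last by lra.
apply: (Rmult_le_reg_r (x ^ 4)) => //.
rewrite Rmult_assoc Rinv_l ?Rmult_1_r; last by lra.
apply: Rle_trans u12 _.
have : (16 * INR C + 1) ^ 1 <= (16 * INR C + 1) ^ 12.
  by apply: Rle_pow; [lra | lia].
by rewrite pow_1; lra.
Qed.
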